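(* Let $A_0,A_1,A_2,A_3$ be a rotation quadrilateral with relative revolute axes $K_{01},K_{12},K_{23},K_{30}$ in the moving space, generic in the sense of the context. Denote by $N$ and $M$ the two transversals of the four axes, by $\mathbf n$ and $\mathbf m$ one of their respective unit direction vectors, and by $p\in N$ and $q\in M$ the feet of the common perpendicular of $N$ and $M$. Then the Gaussian curvature of the elementary quadrilateral formed by the homologous images $A_0(p,\mathbf n),A_1(p,\mathbf n),A_2(p,\mathbf n),A_3(p,\mathbf n)$, and likewise that of the elementary quadrilateral $A_0(q,\mathbf m),\dots,A_3(q,\mathbf m)$, equals $$-\operatorname{twist}^2(N,M)=-\frac{\sin^2\varphi}{d^2},$$ where $d=\operatorname{dist}(p,q)$ and $\varphi$ is the angle between $\mathbf n$ and $\mathbf m$.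
   Context: A cyclic sequence $A_0,A_1,A_2,A_3$ of direct Euclidean displacements $A_i\colon E^3\to E^3$ (from the moving space to the fixed space) is a rotation quadrilateral if any two neighbouring positions (indices mod 4) correspond in a rotation, i.e. $A_{i+1}\circ A_i^{-1}$ is a rotation about a line. The relative revolute axis in the moving space is $K_{i,i+1}=\{x: A_i(x)=A_{i+1}(x)\}$, the preimage under $A_i$ of the axis of $A_{i+1}\circ A_i^{-1}$. A contact element is a pair $(p,\mathbf n)$ of a point $p\in E^3$ and a unit vector $\mathbf n$; a displacement $A$ acts on it by mapping $p$ to $A(p)$ and $\mathbf n$ by the linear part of $A$. The twist of two oriented lines $N,M$ with direction vectors $\mathbf n,\mathbf m$ is $\operatorname{twist}(N,M)=\sin\varphi/d$, where $d$ is the distance between $N$ and $M$ and $\varphi$ is the angle between $\mathbf n$ and $\mathbf m$, measured counter-clockwise when viewed along the ray from the foot $p\in N$ to the foot $q\in M$ of the common perpendicular. Neighbouring contact elements of such a cyclic sequence of homologous images $(p_i,\mathbf n_i)$ have a common oriented tangent sphere ($p_i+r\mathbf n_i=p_{i+1}+r\mathbf n_{i+1}$ for some $r$), so they form an elementary quadrilateral of a principal contact element net: the $p_i$ are concyclic and corresponding edges of the polygons $p_0p_1p_2p_3$ and $\mathbf n_0\mathbf n_1\mathbf n_2\mathbf n_3$ are parallel. The Gaussian curvature of such a quadrilateral is $K=S_0/S$, where $S_0$ is the oriented area of the (planar) quadrilateral with vertices $\mathbf n_0,\dots,\mathbf n_3$ on the unit sphere and $S$ is the oriented area of the quadrilateral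 $p_0,\dots,p_3$ (both with respect to the same unit normal of the parallel planes). Genericity: the four relative revolute axes have exactly two common transversals $N,M$, neighbouring relative revolute axes are skew, and the Gaussian curvatures involved are well defined ($S\ne0$). *)

(* Defs.v *)
From HB Require Import structures.
From mathcomp Require Import all_boot all_order all_algebra.
From mathcomp Require Import boolp classical_sets reals trigo.

Set Implicit Arguments.
Unset Strict Implicit.
Unset Printing Implicit Defensive.

Import Order.TTheory GRing.Theory Num.Theory.

Local Open Scope classical_set_scope.
Local Open Scope ring_scope.

(* Moving space and fixed space are both identified with R^3. *)
Notation E3 R := 'cV[R]_3.

Section Vectors.
Variable R : realType.
Implicit Types u v w : E3 R.

Definition dot u v : R := \sum_i u i 0 * v i 0.

(* Euclidean norm; the library norm on matrices is the sup norm. *)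
Definition norm2 u : R := Num.sqrt (dot u u).

(* (u x v)_k = u_{k+1} v_{k+2} - u_{k+2} v_{k+1}, indices mod 3. *)
Definition cross u v : E3 R :=
  \col_(k < 3) (u (ordS k) 0 * v (ordS (ordS k)) 0
              - u (ordS (ordS k)) 0 * v (ordS k) 0).

(* Unoriented angle, in [0, pi]. *)
Definition angle u v : R := acos (dot u v / (norm2 u * norm2 v)).

(* Angle from u to v (both orthogonal to w) in ]-pi, pi], counter-clockwise
   positive for a viewer looking in the direction w. Such a viewer sees the
   right-handed rotations about w as clockwise, hence the sign. *)
Definition ccw_angle w u v : R :=
  if dot (cross u v) w <= 0 then angle u v else - angle u v.

End Vectors.

Section Lines.
Variable R : realType.
Implicit Types L N M : set (E3 R).

Definition line (p v : E3 R) : set (E3 R) := [set p + t *: v | t in [set: R]].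

Definition is_line L := exists p v : E3 R, v != 0 /\ L = line p v.

Definition parallel N M := exists w : E3 R, M = [set x + w | x in N].

Definition skew_lines N M :=
  [/\ is_line N, is_line M, N `&` M = set0 & ~ parallel N M].

Definition line_dist N M : R :=
  inf [set norm2 (x.1 - x.2) | x in N `*` M].

Definition transversal (K : 'I_4 -> set (E3 R)) L :=
  is_line L /\ forall i, L `&` K i !=set0.

Definition exactly_two_transversals (K : 'I_4 -> set (E3 R)) N M :=
  [/\ transversal K N, transversal K M, N <> M &
      forall L, transversal K L -> L = N \/ L = M].

(* Twist of the oriented lines through p with direction n and through q with
   direction m, where p and q are the feet of their common perpendicular. *)
Definition twist (p n q m : E3 R) : R :=
  sin (ccw_angle (q - p) n m) / line_dist (line p n) (line q m).

End Lines.

Section Displacements.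
Variable R : realType.

(* Direct Euclidean displacement x |-> lin * x + trans. *)
Record displacement := Displacement {
  lin : 'M[R]_3;
  trans : E3 R;
  lin_orth : lin^T *m lin = 1%:M;
  lin_det : \det lin = 1 }.

Definition dapply (A : displacement) (x : E3 R) : E3 R := lin A *m x + trans A.

Coercion dapply : displacement >-> Funclass.

Lemma dinv_orth (A : displacement) : ((lin A)^T)^T *m (lin A)^T = 1%:M.
Proof. by rewrite trmxK; apply: mulmx1C; exact: lin_orth. Qed.

Lemma dinv_det (A : displacement) : \det (lin A)^T = 1.
Proof. by rewrite det_tr lin_det. Qed.

Definition dinv (A : displacement) : displacement :=
  @Displacement _ (- ((lin A)^T *m trans A)) (dinv_orth A) (dinv_det A).

Lemma dcomp_orth (A B : displacement) :
  (lin A *m lin B)^T *m (lin A *m lin B) = 1%:M.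
Proof.
by rewrite trmx_mul -mulmxA (mulmxA _ (lin A)) lin_orth mul1mx lin_orth.
Qed.

Lemma dcomp_det (A B : displacement) : \det (lin A *m lin B) = 1.
Proof. by rewrite det_mulmx !lin_det mulr1. Qed.

Definition dcomp (A B : displacement) : displacement :=
  @Displacement _ (lin A *m trans B + trans A)
    (dcomp_orth A B) (dcomp_det A B).

Lemma dcompE (A B : displacement) x : dcomp A B x = A (B x).
Proof. by rewrite /dapply /= mulmxDr mulmxA addrA. Qed.

Lemma dinvK (A : displacement) : cancel (dinv A) A.
Proof.
move=> x; rewrite /dapply /= -mulmxBr mulmxA.
by rewrite (mulmx1C (lin_orth A)) mul1mx subrK.
Qed.

Lemma dKinv (A : displacement) : cancel A (dinv A).
Proof. by move=> x; rewrite /dapply /= mulmxDr mulmxA lin_orth mul1mx addrK. Qed.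

(* A direct displacement whose set of fixed points is exactly a line is a
   (non-identical) rotation about that line. *)
Definition rotation_about (D : displacement) (L : set (E3 R)) :=
  is_line L /\ [set x | D x = x] = L.

Definition is_rotation (D : displacement) := exists L, rotation_about D L.

(* ordS is the successor mod 4. *)
Definition rotation_quadrilateral (A : 'I_4 -> displacement) :=
  forall i, is_rotation (dcomp (A (ordS i)) (dinv (A i))).

(* revolute_axis A i is K_{i,i+1}, in the moving space. *)
Definition revolute_axis (A : 'I_4 -> displacement) (i : 'I_4) : set (E3 R) :=
  [set x | A i x = A (ordS i) x].

End Displacements.

Section ContactElements.
Variable R : realType.

(* Point and normal vector; that the latter is a unit vector is assumed
   separately and is preserved by displacements. *)
Definition contact_element : Type := (E3 R * E3 R)%type.

Definition act (A : displacement R) (c : contact_element) : contact_element :=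
  (A c.1, lin A *m c.2).

Implicit Type C : 'I_4 -> contact_element.

Definition homologous_images (A : 'I_4 -> displacement R) (c : contact_element)
  : 'I_4 -> contact_element := fun i => act (A i) c.

(* Neighbouring contact elements have a common oriented tangent sphere. *)
Definition elementary_quadrilateral C :=
  forall i, exists r : R,
    (C i).1 + r *: (C i).2 = (C (ordS i)).1 + r *: (C (ordS i)).2.

(* nu is a unit normal of the plane of the p_i and of the parallel plane of the
   n_i. *)
Definition common_unit_normal C (nu : E3 R) :=
  norm2 nu = 1 /\
  forall i j, dot nu ((C i).1 - (C j).1) = 0 /\ dot nu ((C i).2 - (C j).2) = 0.

(* Shoelace formula for a closed polygon in a plane with unit normal nu; it does
   not depend on the choice of the origin. *)
Definition oriented_area (nu : E3 R) (x : 'I_4 -> E3 R) : R :=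
  2^-1 * \sum_i dot (cross (x i) (x (ordS i))) nu.

Definition vertex_area C (nu : E3 R) : R := oriented_area nu (fun i => (C i).1).
Definition normal_area C (nu : E3 R) : R := oriented_area nu (fun i => (C i).2).

Definition curvature_well_defined C :=
  forall nu, common_unit_normal C nu -> vertex_area C nu != 0.

(* The ratio S_0 / S does not depend on the choice of nu among the two common
   unit normals, whose existence is part of the assertion. *)
Definition has_gaussian_curvature C (k : R) :=
  (exists nu, common_unit_normal C nu) /\
  forall nu, common_unit_normal C nu -> normal_area C nu / vertex_area C nu = k.

End ContactElements.

(* Main.v *)
Require Import Defs.
From HB Require Import structures.
From mathcomp Require Import all_boot all_order all_algebra.
From mathcomp Require Import boolp classical_sets reals trigo.
From mathcomp Require Import ring lra.

(* The transversals N and M meet the axis K_{i,i+1} in p + r_i n and q + s_i m,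
   so p_{i+1} - p_i = - r_i (n_{i+1} - n_i), and likewise for q, m, s. The two
   areas of the quadrilateral (q_i, m_i) are then multiples of one and the same
   number, and the theorem reduces to a cubic relation between the s_i.

   Write psi_i for the angle about N of the half-plane containing K_{i,i+1},
   measured from the direction q - p; then tan psi_i = mu s_i where
   mu = (m . (n x (q - p))) / d^2, so mu^2 = sin^2 phi / d^2. On directions,
   A_{i+1} is A_i preceded by the reflection in the plane of N and K_{i,i+1} and
   followed by the reflection exchanging n_i and n_{i+1}. The latter four
   reflections all fix nu, a common normal of the differences n_i - n_j; their
   product also fixes n_0, so it is the identity, and going once around yields
   psi_0 - psi_1 + psi_2 - psi_3 = 0 mod pi. Its tangent is the relation between
   the s_i. Exchanging the roles of N and M gives the other quadrilateral. *)

Set Implicit Arguments.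
Unset Strict Implicit.
Unset Printing Implicit Defensive.

Import Order.TTheory GRing.Theory Num.Theory.

Local Open Scope classical_set_scope.
Local Open Scope ring_scope.

(** * Vector algebra in coordinates *)

Section Vectors.
Context {R : realType}.
Implicit Types (e u v w x y z nu : E3 R) (L : 'M[R]_3).

Lemma col3P u v :
  u 0 0 = v 0 0 -> u 1 0 = v 1 0 -> u 2 0 = v 2 0 -> u = v.
Proof.
move=> e0 e1 e2; apply/matrixP => i j; rewrite [j]ord1 {j}.
case: i => [[|[|[|k]]] lt_k3] //.
- by rewrite (_ : Ordinal _ = 0) //; apply: val_inj.
- by rewrite (_ : Ordinal _ = 1) //; apply: val_inj.
- by rewrite (_ : Ordinal _ = 2) //; apply: val_inj.
Qed.

Lemma sum3E (F : 'I_3 -> R) : \sum_i F i = F 0 + F 1 + F 2.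
Proof.
rewrite !big_ord_recl big_ord0 addr0 addrA.
by congr (_ + F _ + F _); apply: val_inj.
Qed.

Lemma dotE u v : dot u v = u 0 0 * v 0 0 + u 1 0 * v 1 0 + u 2 0 * v 2 0.
Proof. exact: sum3E. Qed.

Lemma crossE u v :
  (cross u v 0 0 = u 1 0 * v 2 0 - u 2 0 * v 1 0) *
  (cross u v 1 0 = u 2 0 * v 0 0 - u 0 0 * v 2 0) *
  (cross u v 2 0 = u 0 0 * v 1 0 - u 1 0 * v 0 0).
Proof.
have S0 : ordS (0 : 'I_3) = 1 by apply: val_inj.
have S1 : ordS (1 : 'I_3) = 2 by apply: val_inj.
have S2 : ordS (2 : 'I_3) = 0 by apply: val_inj.
by rewrite !mxE !(S0, S1, S2).
Qed.

Lemma mulmx3E L u i :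
  (L *m u) i 0 = L i 0 * u 0 0 + L i 1 * u 1 0 + L i 2 * u 2 0.
Proof. by rewrite mxE sum3E. Qed.

Lemma dotC u v : dot u v = dot v u.
Proof. rewrite !dotE; ring. Qed.

Lemma dotDr u v w : dot u (v + w) = dot u v + dot u w.
Proof. rewrite !(dotE, mxE); ring. Qed.
Lemma dotBr u v w : dot u (v - w) = dot u v - dot u w.
Proof. rewrite !(dotE, mxE); ring. Qed.

Lemma det3E L : \det L =
  L 0 0 * (L 1 1 * L 2 2 - L 1 2 * L 2 1)
  - L 0 1 * (L 1 0 * L 2 2 - L 1 2 * L 2 0)
  + L 0 2 * (L 1 0 * L 2 1 - L 1 1 * L 2 0).
Proof.
pose f (i j : nat) := L (inord i) (inord j).
have Lf i j : L i j = f i j by rewrite /f !inord_val.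
rewrite (expand_det_row _ 0) sum3E /cofactor !(expand_det_row _ 0).
rewrite !big_ord_recl !big_ord0 /cofactor !det_mx11 !mxE !Lf /= /bump /=.
ring.
Qed.

Lemma dot_cross_mulmx L u v w :
  dot (L *m u) (cross (L *m v) (L *m w)) = \det L * dot u (cross v w).
Proof. rewrite det3E !(dotE, crossE, mulmx3E); ring. Qed.

Lemma dot_mulmx L u v : L^T *m L = 1%:M -> dot (L *m u) (L *m v) = dot u v.
Proof.
move=> orthL.
have dot_mx (x y : E3 R) : dot x y = (x^T *m y) 0 0.
  by rewrite mxE; apply: eq_bigr => i _; rewrite mxE.
by rewrite !dot_mx trmx_mul -mulmxA (mulmxA L^T) orthL mul1mx.
Qed.

(** Pairing with all [w] determines a vector. Writing [w = L (L^T w)] turns both pairings into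
    triple products, which [L] preserves since [\det L = 1]. *)
Lemma cross_mulmx L u v : L^T *m L = 1%:M -> \det L = 1 ->
  cross (L *m u) (L *m v) = L *m cross u v.
Proof.
move=> orthL detL.
have LK : L *m L^T = 1%:M by exact: mulmx1C.
have dot_r x y z : (forall w, dot w y = dot w z) -> y = z.
  move=> yz; apply/matrixP => i j; rewrite [j]ord1.
  have delta w : dot (delta_mx i 0) w = w i 0.
    rewrite /dot (bigD1 i) //= mxE !eqxx mul1r big1 ?addr0 // => k ki.
    by rewrite mxE (negbTE ki) mul0r.
  by rewrite -!delta.
apply: (dot_r u) => w; rewrite -[w]mul1mx -LK -mulmxA.
by rewrite dot_cross_mulmx detL mul1r dot_mulmx.
Qed.

Lemma dot_ge0 u : 0 <= dot u u.
Proof. by rewrite dotE -!expr2 !addr_ge0 ?sqr_ge0. Qed.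

Lemma dot_eq0 u : (dot u u == 0) = (u == 0).
Proof.
apply/eqP/eqP => [|->]; last by rewrite dotE !mxE; ring.
rewrite dotE -!expr2 => /eqP.
rewrite paddr_eq0 ?addr_ge0 ?sqr_ge0 // paddr_eq0 ?sqr_ge0 // !sqrf_eq0.
by move=> /andP[/andP[/eqP u0 /eqP u1] /eqP u2]; apply: col3P; rewrite mxE.
Qed.

Lemma norm2_sqr u : norm2 u ^+ 2 = dot u u.
Proof. by rewrite sqr_sqrtr // dot_ge0. Qed.

(** Expanding [(u . (v x w)) e] over the vectors [v x w], [w x u], [u x v] gives the coefficients
    [u . e], [v . e], [w . e], all zero. *)
Lemma perp_triple e u v w : e != 0 ->
  dot u e = 0 -> dot v e = 0 -> dot w e = 0 -> dot u (cross v w) = 0.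
Proof.
move=> e0 ue ve we.
have triple_e : dot u (cross v w) *: e =
    dot u e *: cross v w + dot v e *: cross w u + dot w e *: cross u v.
  by apply: col3P; rewrite !(dotE, crossE, mxE); ring.
move: triple_e; rewrite ue ve we !scale0r !addr0 => /eqP.
by rewrite scaler_eq0 (negbTE e0) orbF => /eqP.
Qed.

Lemma exists_perp u v :
  exists nu, [/\ norm2 nu = 1, dot nu u = 0 & dot nu v = 0].
Proof.
pose B : 'M[R]_(3, 1 + 1) := row_mx u v.
(* [u] and [v] may be parallel, so [cross u v] will not do; the 3 by 2 matrix [B] always has a
   nonzero left kernel. *)
have /rowV0Pn[x /sub_kermxP xB x0] : kermx B != 0.
  rewrite -mxrank_eq0 mxrank_ker subn_eq0 -ltnNge.
  by apply: leq_ltn_trans (rank_leq_col _) _.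
have dotx (w : E3 R) : dot x^T w = (x *m w) 0 0.
  by rewrite mxE; apply: eq_bigr => i _; rewrite mxE.
have xT0 : x^T != 0 by rewrite trmx_eq0.
have [xu xv] : x *m u = 0 /\ x *m v = 0.
  move: xB; rewrite /B mul_mx_row -row_mx0 => /eq_row_mx[]//.
have nx : norm2 x^T != 0.
  by rewrite -sqrf_eq0 norm2_sqr dot_eq0.
have dotZ a (y z : E3 R) : dot (a *: y) z = a * dot y z.
  by rewrite !(dotE, mxE); ring.
exists ((norm2 x^T)^-1 *: x^T); split.
- rewrite {1}/norm2 dotZ dotC dotZ -norm2_sqr.
  by rewrite expr2 mulKf // mulVf // sqrtr1.
- by rewrite dotZ dotx xu mxE mulr0.
- by rewrite dotZ dotx xv mxE mulr0.
Qed.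
End Vectors.

(** * Indices modulo 4 *)

Section Cyclic.

Lemma ordS4E : ((ordS (0 : 'I_4) = 1) * (ordS (1 : 'I_4) = 2) *
  (ordS (2 : 'I_4) = 3) * (ordS (3 : 'I_4) = 0))%type.
Proof. by do !split; apply: val_inj. Qed.

Lemma forall_ord4 (P : 'I_4 -> Prop) :
  P 0 -> P 1 -> P 2 -> P 3 -> forall i, P i.
Proof.
move=> P0 P1 P2 P3 [[|[|[|[|k]]]] lt_k4] //.
- by rewrite (_ : Ordinal _ = 0) //; apply: val_inj.
- by rewrite (_ : Ordinal _ = 1) //; apply: val_inj.
- by rewrite (_ : Ordinal _ = 2) //; apply: val_inj.
- by rewrite (_ : Ordinal _ = 3) //; apply: val_inj.
Qed.

Lemma sum4E (V : nmodType) (F : 'I_4 -> V) : \sum_i F i = F 0 + F 1 + F 2 + F 3.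
Proof.
rewrite !big_ord_recl big_ord0 addr0 !addrA.
by congr (_ + F _ + F _ + F _); apply: val_inj.
Qed.

End Cyclic.

(** * The closure relation, and the areas of a closed quadrilateral *)

Section Closure.
Context {R : realType}.
Implicit Types (nu u v : E3 R).

(* The axis direction [k = d + t (u x d) + c u] is orthogonal
   to [v - u], and so are [u + v] and [nu]; hence [nu . ((u + v) x k) = 0]. *)
Lemma axis_step nu u v d d' (t c : R) :
  dot u u = 1 -> dot v v = 1 -> dot u d = 0 -> dot v d' = 0 -> u <> v ->
  dot nu u = dot nu v ->
  d + t *: cross u d + c *: u = d' + t *: cross v d' + c *: v ->
  dot nu d + t * dot nu (cross u d) = dot nu d' + t * dot nu (cross v d') /\
  dot nu (cross u d) - t * dot nu d + dot nu (cross v d') - t * dot nu d' = 0.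
Proof.
move=> uu vv ud vd' uv nuv Ek.
set k := d + _ + _ in Ek.
have dot_frame (w x y z : E3 R) (a b : R) :
    dot w (x + a *: y + b *: z) = dot w x + a * dot w y + b * dot w z.
  by rewrite !(dotE, mxE); ring.
have cross_frame (x y : E3 R) : dot x x = 1 -> dot x y = 0 ->
    dot nu (cross x (y + t *: cross x y + c *: x)) =
    dot nu (cross x y) - t * dot nu y.
  move=> xx xy.
  suff -> : dot nu (cross x (y + t *: cross x y + c *: x)) =
    dot nu (cross x y) + t * (dot x y * dot nu x - dot x x * dot nu y).
    by rewrite xx xy; ring.
  by rewrite !(dotE, crossE, mxE); ring.
split.
  by have := congr1 (dot nu) Ek; rewrite /k !dot_frame nuv => /addIr.
have e0 : v - u != 0 by rewrite subr_eq0; apply/eqP => /esym.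
have xcross (x y : E3 R) : dot x (cross x y) = 0.
  by rewrite !(dotE, crossE); ring.
(* [k] has the same component [c] along [u] and along [v]. *)
have ke : dot k (v - u) = 0.
  rewrite dotBr {1}Ek (dotC _ v) /k (dotC _ u) !dot_frame !xcross.
  by rewrite uu vv ud vd'; ring.
have se : dot (u + v) (v - u) = 0.
  transitivity (dot v v - dot u u); last by rewrite uu vv subrr.
  by rewrite !(dotE, mxE); ring.
have nue : dot nu (v - u) = 0 by rewrite dotBr nuv subrr.
have := perp_triple e0 nue se ke.
have -> : dot nu (cross (u + v) k) = dot nu (cross u k) + dot nu (cross v k).
  by rewrite !(dotE, crossE, mxE); ring.
by rewrite {2}Ek /k !cross_frame // addrA.
Qed.

(* The pairs [(a i, b i)] are complex numbers [a i + 'i * b i]; the two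
   hypotheses say that multiplication by [1 + 'i * t i] maps the [i]-th one to
   minus the conjugate of [(1 + 'i * t i) * (a (i+1) + 'i * b (i+1))]. Going
   once around gives [z = conj z] for
   [z = (1 + 'i t0) (1 - 'i t1) (1 + 'i t2) (1 - 'i t3)]. *)
Lemma half_angle_closure (a b t : 'I_4 -> R) :
  (forall i, b i + t i * a i = b (ordS i) + t i * a (ordS i)) ->
  (forall i, a i - t i * b i + a (ordS i) - t i * b (ordS i) = 0) ->
  a 0 != 0 \/ b 0 != 0 ->
  t 0 - t 1 + t 2 - t 3 + t 0 * t 1 * t 2 - t 0 * t 1 * t 3
    + t 0 * t 2 * t 3 - t 1 * t 2 * t 3 = 0.
Proof.
move=> Hb Ha ab0.
have := (Hb 0, Hb 1, Hb 2, Hb 3, (Ha 0, Ha 1, Ha 2, Ha 3)).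
rewrite !ordS4E => -[[[[b01 b12] b23] b30] [[[a01 a12] a23] a30]] {Ha Hb}.
move: b01 b12 b23 b30 a01 a12 a23 a30 ab0.
move: (a 0) (a 1) (a 2) (a 3) (b 0) (b 1) (b 2) (b 3) (t 0) (t 1) (t 2) (t 3).
move=> a0 a1 a2 a3 b0 b1 b2 b3 t0 t1 t2 t3 b01 b12 b23 b30 a01 a12 a23 a30 ab0.
have sub0 (x y : R) : x = y -> x - y = 0 by move=> ->; rewrite subrr.
(* For [w = (1 + 'i s1) (1 - 'i s2)], two consecutive hypotheses combine to [w z1 = conj w * z3];
   the conclusions are its real and imaginary parts. *)
have step (x1 y1 x2 y2 x3 y3 s1 s2 : R) :
    y1 + s1 * x1 = y2 + s1 * x2 -> x1 - s1 * y1 + x2 - s1 * y2 = 0 ->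
    y2 + s2 * x2 = y3 + s2 * x3 -> x2 - s2 * y2 + x3 - s2 * y3 = 0 ->
    (1 + s1 * s2) * x1 - (s1 - s2) * y1 = (1 + s1 * s2) * x3 + (s1 - s2) * y3 /\
    (1 + s1 * s2) * y1 + (s1 - s2) * x1 = (1 + s1 * s2) * y3 - (s1 - s2) * x3.
  move=> /sub0 h1 h2 /sub0 h3 h4.
  split; apply/eqP; rewrite -subr_eq0; apply/eqP.
    transitivity (s2 * (y1 + s1 * x1 - (y2 + s1 * x2))
      + (x1 - s1 * y1 + x2 - s1 * y2) + s1 * (y2 + s2 * x2 - (y3 + s2 * x3))
      - (x2 - s2 * y2 + x3 - s2 * y3)); first ring.
    by rewrite h1 h2 h3 h4; ring.
  transitivity ((y1 + s1 * x1 - (y2 + s1 * x2))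
    - s2 * (x1 - s1 * y1 + x2 - s1 * y2) + (y2 + s2 * x2 - (y3 + s2 * x3))
    + s1 * (x2 - s2 * y2 + x3 - s2 * y3)); first ring.
  by rewrite h1 h2 h3 h4; ring.
have [/sub0 re02 /sub0 im02] := step _ _ _ _ _ _ _ _ b01 a01 b12 a12.
have [/sub0 re20 /sub0 im20] := step _ _ _ _ _ _ _ _ b23 a23 b30 a30.
set T := LHS.
(* [T] is the imaginary part of the product of the two factors [w] for the halves of the cycle.
   Eliminating [a2 + 'i b2] leaves [2 'i T (a0 + 'i b0) = 0]; [Ta] is its imaginary part, [Tb] minus
   its real part. *)
have Ta : 2 * (T * a0) = 0.
  transitivity ((1 + t2 * t3) * ((1 + t0 * t1) * b0 + (t0 - t1) * a0
      - ((1 + t0 * t1) * b2 - (t0 - t1) * a2))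
    + (t2 - t3) * ((1 + t0 * t1) * a0 - (t0 - t1) * b0
      - ((1 + t0 * t1) * a2 + (t0 - t1) * b2))
    + (1 + t0 * t1) * ((1 + t2 * t3) * b2 + (t2 - t3) * a2
      - ((1 + t2 * t3) * b0 - (t2 - t3) * a0))
    - (t0 - t1) * ((1 + t2 * t3) * a2 - (t2 - t3) * b2
      - ((1 + t2 * t3) * a0 + (t2 - t3) * b0))); first by rewrite /T; ring.
  by rewrite re02 im02 re20 im20; ring.
have Tb : 2 * (T * b0) = 0.
  transitivity (- (1 + t2 * t3) * ((1 + t0 * t1) * a0 - (t0 - t1) * b0
      - ((1 + t0 * t1) * a2 + (t0 - t1) * b2))
    + (t2 - t3) * ((1 + t0 * t1) * b0 + (t0 - t1) * a0
      - ((1 + t0 * t1) * b2 - (t0 - t1) * a2))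
    - (1 + t0 * t1) * ((1 + t2 * t3) * a2 - (t2 - t3) * b2
      - ((1 + t2 * t3) * a0 + (t2 - t3) * b0))
    - (t0 - t1) * ((1 + t2 * t3) * b2 + (t2 - t3) * a2
      - ((1 + t2 * t3) * b0 - (t2 - t3) * a0))); first by rewrite /T; ring.
  by rewrite re02 im02 re20 im20; ring.
have two0 : 2 != 0 :> R by rewrite pnatr_eq0.
case: ab0 => [nz|nz].
  by move/eqP: Ta; rewrite !mulf_eq0 (negbTE two0) (negbTE nz) orbF => /eqP.
by move/eqP: Tb; rewrite !mulf_eq0 (negbTE two0) (negbTE nz) orbF => /eqP.
Qed.

(* Eliminating the edges [e2], [e3] through the two linear relations between
   the four edges leaves both areas as multiples of that of [e0], [e1]. *)
Lemma area_factor nu (P n : 'I_4 -> E3 R) (r : 'I_4 -> R) :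
  (forall i, P i + r i *: n i = P (ordS i) + r i *: n (ordS i)) ->
  r 3 != r 2 ->
  exists E : R,
    oriented_area nu n = (r 3 - r 2 + (r 1 - r 0)) * E /\
    oriented_area nu P =
      (r 0 * r 1 * (r 3 - r 2) + r 2 * r 3 * (r 1 - r 0)) * E.
Proof.
move=> HP r32.
(* The diagonal from [x 0] to [x 2] cuts the quadrilateral into two triangles. *)
have areaE (x : 'I_4 -> E3 R) : oriented_area nu x = 2^-1 *
    (dot nu (cross (x 1 - x 0) (x 2 - x 1))
     + dot nu (cross (x 3 - x 2) (x 0 - x 3))).
  rewrite /oriented_area sum4E !ordS4E; congr (_ * _).
  by rewrite !(dotE, crossE, mxE); ring.
have edge i : P (ordS i) - P i = - r i *: (n (ordS i) - n i).
  apply/matrixP => j k; have /matrixP/(_ j k) := HP i.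
  by rewrite !mxE; lra.
have := (edge 0, edge 1, edge 2, edge 3); rewrite !ordS4E.
move=> -[[[P01 P12] P23] P30].
rewrite !areaE P01 P12 P23 P30.
have sumn : (n 1 - n 0) + (n 2 - n 1) + (n 3 - n 2) + (n 0 - n 3) = 0.
  by apply: col3P; rewrite !mxE; ring.
have sumP : - r 0 *: (n 1 - n 0) - r 1 *: (n 2 - n 1)
    - r 2 *: (n 3 - n 2) - r 3 *: (n 0 - n 3) = 0.
  rewrite -!scaleNr -P01 -P12 -P23 -P30.
  by apply: col3P; rewrite !mxE; ring.
move: (n 1 - n 0) (n 2 - n 1) (n 3 - n 2) (n 0 - n 3) sumn sumP.
move=> e0 e1 e2 e3 sumn sumP {P01 P12 P23 P30 edge areaE HP}.
have rd : r 3 - r 2 != 0 by rewrite subr_eq0.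
have sum_r (x y : R) : x *: (e0 + e1 + e2 + e3)
    + y *: (- r 0 *: e0 - r 1 *: e1 - r 2 *: e2 - r 3 *: e3) = 0.
  by rewrite sumn sumP !scaler0 addr0.
(* The multipliers [r 3] and [1] cancel [e3] from the two closing relations; for [e3E], [- r 2] and
   [- 1] cancel [e2]. *)
have e2E : (r 3 - r 2) *: e2 = (r 0 - r 3) *: e0 + (r 1 - r 3) *: e1.
  apply/eqP; rewrite -subr_eq0 -(sum_r (r 3) 1); apply/eqP.
  by apply: col3P; rewrite !mxE; ring.
have e3E : (r 3 - r 2) *: e3 = (r 2 - r 0) *: e0 + (r 2 - r 1) *: e1.
  apply/eqP; rewrite -subr_eq0 -(sum_r (- r 2) (- 1)); apply/eqP.
  by apply: col3P; rewrite !mxE; ring.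
have cross23 : (r 3 - r 2) * dot nu (cross e2 e3) =
    (r 1 - r 0) * dot nu (cross e0 e1).
  apply: (mulfI rd).
  transitivity (dot nu (cross ((r 3 - r 2) *: e2) ((r 3 - r 2) *: e3))).
    by rewrite !(dotE, crossE, mxE); ring.
  by rewrite e2E e3E !(dotE, crossE, mxE); ring.
have crossZ (x y : R) (u v : E3 R) :
    dot nu (cross (x *: u) (y *: v)) = x * y * dot nu (cross u v).
  by rewrite !(dotE, crossE, mxE); ring.
have {}cross23 : dot nu (cross e2 e3) =
    (r 1 - r 0) / (r 3 - r 2) * dot nu (cross e0 e1).
  by apply: (mulfI rd); rewrite cross23; field.
exists (2^-1 * (dot nu (cross e0 e1) / (r 3 - r 2))).
by rewrite !crossZ cross23; split; field.
Qed.

(** Take [nu] orthogonal to two edges of the polygon of normals. The heights [x] and [y] along [nu]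
    then agree at the indices 0, 1, 2, and closing the cycle gives [(r 3 - r 2) (x 3 - x 2) = 0]. *)
Lemma exists_common_unit_normal (C : 'I_4 -> contact_element R)
    (r : 'I_4 -> R) :
  (forall i, (C i).1 + r i *: (C i).2 =
    (C (ordS i)).1 + r i *: (C (ordS i)).2) ->
  r 3 != r 2 -> exists nu, common_unit_normal C nu.
Proof.
move=> HC r32.
have [nu [nu1 nu01 nu12]] :=
  exists_perp ((C 1).2 - (C 0).2) ((C 2).2 - (C 1).2).
exists nu; split => //.
pose x i := dot nu (C i).2; pose y i := dot nu (C i).1.
have xy i : y i + r i * x i = y (ordS i) + r i * x (ordS i).
  have := congr1 (dot nu) (HC i).
  by rewrite !dotDr !(_ : forall a u, dot nu (a *: u) = a * dot nu u) // => a u;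
    rewrite !(dotE, mxE); ring.
have := (xy 0, xy 1, xy 2, xy 3); rewrite !ordS4E => -[[[h0 h1] h2] h3].
have x10 : x 1 = x 0 by apply/eqP; rewrite -subr_eq0 -dotBr; apply/eqP.
have x21 : x 2 = x 1 by apply/eqP; rewrite -subr_eq0 -dotBr; apply/eqP.
have x32 : x 3 = x 2.
  have rd : r 3 - r 2 != 0 by rewrite subr_eq0.
  apply: (mulfI rd); move: h0 h1 h2 h3; rewrite x21 x10; lra.
have xE i : x i = x 0.
  by move: i; apply: forall_ord4; rewrite ?x32 ?x21 ?x10.
have yE i : y i = y 0.
  move: i; have yS i : y (ordS i) = y i by have := xy i; rewrite !xE => /addIr.
  have := (yS 0, yS 1, yS 2); rewrite !ordS4E => -[[y10 y21] y32].
  by apply: forall_ord4; rewrite ?y32 ?y21 ?y10.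
by move=> i j; rewrite !dotBr -/(x i) -/(x j) -/(y i) -/(y j) !xE !yE !subrr.
Qed.
End Closure.

(** * The curvature as a consequence of the closure relation *)

Section Curvature.
Context {R : realType}.
Implicit Types (A : 'I_4 -> displacement R) (p q n m x y : E3 R).

Lemma dapplyB (A : displacement R) x y : A x - A y = lin A *m (x - y).
Proof. by rewrite /dapply mulmxBr opprD addrACA subrr addr0. Qed.

Lemma dapplyDZ (B : displacement R) x y (t : R) :
  B (x + t *: y) = B x + t *: (lin B *m y).
Proof. by rewrite /dapply mulmxDr -scalemxAr addrAC. Qed.

(** [n], [D], [cross n D] are orthogonal and [cross n D] is as long as [D]. The remainder is
    orthogonal to all three; were it nonzero, [perp_triple] would make [cross n D] vanish. *)
Lemma cross_decomposition n D m :
  dot n n = 1 -> dot n D = 0 -> dot m D = 0 -> D != 0 ->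
  m = (dot m (cross n D) / dot D D) *: cross n D + dot m n *: n.
Proof.
move=> nn nD mD D0; have DD : dot D D != 0 by rewrite dot_eq0.
pose g := cross n D.
have ng : dot n g = 0 by rewrite !(dotE, crossE); ring.
have Dg : dot D g = 0 by rewrite !(dotE, crossE); ring.
have gg : dot g g = dot D D.
  transitivity (dot n n * dot D D - dot n D ^+ 2).
    by rewrite !(dotE, crossE); ring.
  by rewrite nn nD; ring.
apply/eqP; rewrite -subr_eq0; apply/negP => /negP v0.
have dotv w : dot w (m - (dot m g / dot D D *: g + dot m n *: n)) =
    dot w m - (dot m g / dot D D * dot w g + dot m n * dot w n).
  by rewrite !(dotE, mxE); ring.
suff : dot g (cross n D) = 0 by rewrite gg => /eqP; rewrite (negbTE DD).
apply: (perp_triple v0); rewrite -/g dotv.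
- by rewrite gg (dotC g n) ng divfK // dotC; ring.
- by rewrite ng nn dotC; ring.
- by rewrite Dg (dotC D n) nD (dotC D m) mD; ring.
Qed.

(** One half of the theorem; the other follows by exchanging [(p, n)] with [(q, m)]. *)
Lemma gaussian_curvature_homologous A p n q m (r s : 'I_4 -> R) :
  (forall i, A i (p + r i *: n) = A (ordS i) (p + r i *: n)) ->
  (forall i, A i (q + s i *: m) = A (ordS i) (q + s i *: m)) ->
  dot n n = 1 -> dot m m = 1 -> dot (q - p) n = 0 -> dot (q - p) m = 0 ->
  q - p != 0 -> dot m (cross n (q - p)) != 0 ->
  (forall i, lin (A i) *m n <> lin (A (ordS i)) *m n) ->
  r 3 != r 2 -> s 3 != s 2 ->
  curvature_well_defined (homologous_images A (q, m)) ->
  has_gaussian_curvature (homologous_images A (q, m))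
    (- ((1 - dot n m ^+ 2) / dot (q - p) (q - p))).
Proof.
move=> rP sP nn mm Dn Dm D0 tri nS r32 s32 S0.
have imE x (t : R) w i : A i (x + t *: w) = A (ordS i) (x + t *: w) ->
    A i x + t *: (lin (A i) *m w) = A (ordS i) x + t *: (lin (A (ordS i)) *m w).
  by rewrite !dapplyDZ.
pose D := q - p; pose mu := dot m (cross n D) / dot D D.
have DD : dot D D != 0 by rewrite dot_eq0.
have nD : dot n D = 0 by rewrite dotC.
have mD : dot m D = 0 by rewrite dotC.
have mE := cross_decomposition nn nD mD D0; rewrite -/mu in mE.
have mu0 : mu != 0 by rewrite mulf_neq0 ?invr_eq0.
(* The squared length of [m], read off from [mE], is [mu ^+ 2 * dot D D + dot n m ^+ 2]. *)
have mu2 : mu ^+ 2 = (1 - dot n m ^+ 2) / dot D D.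
  rewrite -mm {1 2}mE; set c := dot m n.
  have -> : dot (mu *: cross n D + c *: n) (mu *: cross n D + c *: n) =
     mu ^+ 2 * (dot n n * dot D D - dot n D ^+ 2) + c ^+ 2 * dot n n.
    by rewrite !(dotE, crossE, mxE); ring.
  by rewrite nn nD (dotC n m) -/c; field.
pose N i := lin (A i) *m n; pose d i := lin (A i) *m D.
(* This normal belongs to the quadrilateral of [(p, n)], not to that of [(q, m)]: [axis_step] needs
   [nu . N i] to be constant. *)
have [nu [nu1 nuC]] :
    exists nu, common_unit_normal (homologous_images A (p, n)) nu.
  by apply: (@exists_common_unit_normal _ _ r) => // i; exact: imE.
have nuN i j : dot nu (N i) = dot nu (N j).
  by apply/eqP; rewrite -subr_eq0 -dotBr; have [_ /eqP] := nuC i j.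
have NN i : dot (N i) (N i) = 1 by rewrite dot_mulmx ?lin_orth.
have Nd i : dot (N i) (d i) = 0 by rewrite dot_mulmx ?lin_orth.
(* The vector from the point of [N] to the point of [M] on the axis [K_{i,i+1}] has the same image
   under both positions; it is written in the frame [D], [cross n D], [n]. *)
have axis i :
    d i + (s i * mu) *: cross (N i) (d i) + (s i * dot m n - r i) *: N i
   = d (ordS i) + (s i * mu) *: cross (N (ordS i)) (d (ordS i))
     + (s i * dot m n - r i) *: N (ordS i).
  have LE B :
      d B + (s i * mu) *: cross (N B) (d B) + (s i * dot m n - r i) *: N B
      = A B (q + s i *: m) - A B (p + r i *: n).
    rewrite cross_mulmx ?lin_orth ?lin_det // dapplyB.
    rewrite !scalemxAr -!mulmxDr; congr (_ *m _).
    by rewrite {2}mE /D; apply/matrixP => j k; rewrite !mxE; ring.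
  by rewrite !LE rP sP.
have := @half_angle_closure _ (fun i => dot nu (cross (N i) (d i)))
  (fun i => dot nu (d i)) (fun i => s i * mu).
have step i := axis_step (NN i) (NN (ordS i)) (Nd i) (Nd (ordS i))
  (nS i) (nuN i (ordS i)) (axis i).
move=> /(_ (fun i => (step i).1) (fun i => (step i).2)) closure.
have {}closure : s 0 - s 1 + s 2 - s 3 + mu ^+ 2 * (s 0 * s 1 * s 2
    - s 0 * s 1 * s 3 + s 0 * s 2 * s 3 - s 1 * s 2 * s 3) = 0.
  apply: (mulfI mu0); rewrite mulr0 -[RHS]closure; first by ring.
  (* If both numbers vanish, [nu] is orthogonal to [d 0] and [cross (N 0) (d 0)], hence parallel to
     [N 0]. Then [N 0 - N 1], orthogonal to [nu], is orthogonal to [N 0], which forces the unit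
     vectors [N 0] and [N 1] to coincide. *)
  have [a0|] := eqVneq; last by left.
  have [b0|] := eqVneq; last by right.
  have nu_neq0 : nu != 0.
    rewrite -dot_eq0 -norm2_sqr nu1 expr1n; exact: oner_neq0.
  have Ne : dot (N 0 - N (ordS 0)) nu = 0.
    by rewrite dotC dotBr (nuN _ 0) subrr.
  rewrite dotC in a0; rewrite dotC in b0.
  have := perp_triple nu_neq0 Ne b0 a0.
  have cross_crossE (u v w : E3 R) :
      dot u (cross v (cross w v)) = dot v v * dot u w - dot w v * dot u v.
    by rewrite !(dotE, crossE); ring.
  rewrite cross_crossE Nd mul0r subr0 => /eqP.
  rewrite mulf_eq0 dot_mulmx ?lin_orth // (negbTE DD) /= => /eqP N01.
  case: (nS 0); apply/eqP; rewrite -subr_eq0 -/(N 0) -/(N (ordS 0)) -dot_eq0.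
  have -> : dot (N 0 - N (ordS 0)) (N 0 - N (ordS 0)) =
      2 * dot (N 0 - N (ordS 0)) (N 0) - dot (N 0) (N 0)
      + dot (N (ordS 0)) (N (ordS 0)).
    by rewrite !(dotE, mxE); ring.
  by rewrite N01 !NN; apply/eqP; ring.
split.
  by apply: (@exists_common_unit_normal _ _ s) => // i; exact: imE.
move=> nu' nu'C; have := S0 nu' nu'C.
rewrite /vertex_area /normal_area.
have [|E [-> ->]] := @area_factor _ nu' (fun i => A i q)
  (fun i => lin (A i) *m m) s _ s32.
  by move=> i; exact: imE.
set X := (_ * _ + _) => XE.
(* This is the closure relation: its cubic part is [- X]. *)
have -> : s 3 - s 2 + (s 1 - s 0) = - mu ^+ 2 * X.
  by move: closure; rewrite /X; lra.
by rewrite -mu2 -[_ * X * E]mulrA mulfK.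
Qed.

End Curvature.

(** * Consequences of genericity, and the twist *)

Section Transversals.
Context {R : realType}.
Implicit Types (A : 'I_4 -> displacement R) (p q n m x y k l : E3 R)
  (L : set (E3 R)).

Lemma cross_eq0_collinear k l : k != 0 -> cross k l = 0 ->
  l = (dot k l / dot k k) *: k.
Proof.
move=> k0 kl0; have kk : dot k k != 0 by rewrite dot_eq0.
have eqv : dot k k *: l = dot k l *: k + cross (cross k l) k.
  by apply: col3P; rewrite !(dotE, crossE, mxE); ring.
have cross0 : cross 0 k = 0 by apply: col3P; rewrite !(crossE, mxE); ring.
rewrite kl0 cross0 addr0 in eqv.
by rewrite mulrC -scalerA -eqv scalerA mulVf // scale1r.
Qed.

Lemma line_scale p k (c : R) : c != 0 -> line p (c *: k) = line p k.
Proof.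
move=> c0; apply/seteqP; split => _ [t _ <-].
  by exists (t * c) => //; rewrite scalerA.
by exists (t / c) => //; rewrite scalerA divfK.
Qed.

Lemma line_shift p k (c : R) : line (p + c *: k) k = line p k.
Proof.
apply/seteqP; split => _ [t _ <-].
  by exists (c + t) => //; rewrite scalerDl addrA.
by exists (t - c) => //; rewrite -addrA -scalerDl subrKC.
Qed.

(** If [cross k l] vanishes, the lines are translates of each other; otherwise they meet, the point
    being found by expanding [y - x] in the basis [k], [l], [cross k l]. *)
Lemma coplanar_not_skew x k y l : k != 0 -> l != 0 ->
  dot (y - x) (cross k l) = 0 -> ~ skew_lines (line x k) (line y l).
Proof.
move=> k0 l0 coplanar [_ _ disj npar]; have [kl0|kl0] := eqVneq (cross k l) 0.
  apply: npar; exists (y - x).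
  have lE := cross_eq0_collinear k0 kl0.
  have c0 : dot k l / dot k k != 0.
    by apply: contraNneq l0 => c0; rewrite lE c0 scale0r.
  rewrite lE line_scale //.
  apply/seteqP; split => [_ [t _ <-]|_ [_ [t _ <-] <-]].
    by exists (x + t *: k); [exists t|rewrite addrC addrA subrK].
  by exists t => //; rewrite addrAC subrKC.
have cc : dot (cross k l) (cross k l) != 0 by rewrite dot_eq0.
set c := cross k l in coplanar kl0 cc *.
have eqv : dot c c *: (y - x) = dot (cross (y - x) l) c *: k
    - dot (cross (y - x) k) c *: l + dot (y - x) c *: c.
  by apply: col3P; rewrite /c !(dotE, crossE, mxE); ring.
rewrite coplanar scale0r addr0 in eqv.
suff : (line x k `&` line y l) (x + (dot (cross (y - x) l) c / dot c c) *: k).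
  by rewrite disj.
split; first by eexists.
exists (dot (cross (y - x) k) c / dot c c) => //.
apply: (scalerI cc).
rewrite !scalerDr !scalerA ![_ c c * (_ / _)]mulrC !divfK //.
apply/eqP; rewrite -subr_eq0; apply/eqP.
transitivity (dot c c *: (y - x) - (dot (cross (y - x) l) c *: k
    - dot (cross (y - x) k) c *: l)); last by rewrite eqv subrr.
by apply/matrixP => i j; rewrite !mxE; ring.
Qed.

Lemma line_through L x y : is_line L -> L x -> L y -> x != y ->
  L = line x (y - x).
Proof.
move=> [z [k [k0 ->]]] [a _ <-] [b _ <-] xy.
have ab : b - a != 0.
  by apply: contraNneq xy => /eqP; rewrite subr_eq0 => /eqP ->.
rewrite (_ : _ - _ = (b - a) *: k) ?line_scale // ?line_shift //.
by apply: col3P; rewrite !mxE; ring.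
Qed.

Lemma axis_affine A i x y (t : R) :
  revolute_axis A i x -> revolute_axis A i y ->
  revolute_axis A i (x + t *: (y - x)).
Proof.
rewrite /revolute_axis /= => hx hy.
by rewrite !dapplyDZ -!dapplyB hx hy.
Qed.

(** By Pythagoras, [q - p] being orthogonal to every [s *: n - t *: m], the infimum is attained at
    the feet. *)
Lemma line_dist_feet p n q m : dot (q - p) n = 0 -> dot (q - p) m = 0 ->
  line_dist (line p n) (line q m) = norm2 (q - p).
Proof.
move=> Dn Dm.
set S := [set norm2 (x.1 - x.2) | x in line p n `*` line q m].
have lbS : lbound S (norm2 (q - p)).
  move=> _ [[_ _] /= [[s _ <-] [t _ <-]] <-]; rewrite ler_sqrt ?dot_ge0 //.
  have -> : dot (p + s *: n - (q + t *: m)) (p + s *: n - (q + t *: m)) =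
      dot (q - p) (q - p) + dot (s *: n - t *: m) (s *: n - t *: m)
      - 2 * s * dot (q - p) n + 2 * t * dot (q - p) m.
    by rewrite !(dotE, mxE); ring.
  by rewrite Dn Dm !mulr0 subr0 addr0 lerDl dot_ge0.
have Sd : S (norm2 (q - p)).
  exists (p, q); first by split; exists 0 => //; rewrite scale0r addr0.
  by rewrite /= /norm2; congr Num.sqrt; rewrite !(dotE, mxE); ring.
apply/eqP; rewrite eq_le; apply/andP; split.
  by apply: ge_inf => //; exists (norm2 (q - p)).
by apply: lb_le_inf => //; exists (norm2 (q - p)).
Qed.

Lemma sin_angle_sqr n m : norm2 n = 1 -> norm2 m = 1 ->
  sin (angle n m) ^+ 2 = 1 - dot n m ^+ 2.
Proof.
move=> n1 m1; rewrite /angle n1 m1 mulr1 divr1.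
have nn : dot n n = 1 by rewrite -norm2_sqr n1 expr1n.
have mm : dot m m = 1 by rewrite -norm2_sqr m1 expr1n.
(* Lagrange's identity; it places [dot n m] in the domain where [sin_acos] applies. *)
have CS : 0 <= 1 - dot n m ^+ 2.
  suff -> : 1 - dot n m ^+ 2 = dot (cross n m) (cross n m) by exact: dot_ge0.
  transitivity (dot n n * dot m m - dot n m ^+ 2); first by rewrite nn mm mulr1.
  by rewrite !(dotE, crossE); ring.
rewrite sin_acos ?sqr_sqrtr //.
by rewrite -ler_norml -(@expr_le1 _ 2) // real_normK ?num_real // -subr_ge0.
Qed.

Lemma twist_sqr p n q m :
  norm2 n = 1 -> norm2 m = 1 -> dot (q - p) n = 0 -> dot (q - p) m = 0 ->
  twist p n q m ^+ 2 = sin (angle n m) ^+ 2 / norm2 (q - p) ^+ 2.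
Proof.
move=> n1 m1 Dn Dm; rewrite /twist line_dist_feet // expr_div_n; congr (_ / _).
by rewrite /ccw_angle; case: ifP; rewrite // sinN sqrrN.
Qed.

(** Each axis would pass through [p] or lie in the plane of the two lines, so a further line of the
    pencil at [p] in that plane would be a third transversal. *)
Lemma transversals_not_concurrent A p n m (r s : 'I_4 -> R) :
  (forall i, revolute_axis A i (p + r i *: n)) ->
  (forall i, revolute_axis A i (p + s i *: m)) ->
  n != 0 -> m != 0 ->
  ~ exactly_two_transversals (revolute_axis A) (line p n) (line p m).
Proof.
move=> rK sK n0 m0 [_ _ NM uniqNM].
have nm : cross n m != 0.
  apply/negP => /eqP /(cross_eq0_collinear n0) mE; apply: NM.
  rewrite mE line_scale //; apply: contraNneq m0 => c0.
  by rewrite mE c0 scale0r.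
(* Exceeding every [|s i / r i|] keeps the new line from being parallel to an axis with [r i != 0];
   an axis with [r i = 0] passes through [p]. *)
pose t := 1 + \sum_i `|s i / r i|.
have t_gt0 : 0 < t by rewrite ltr_wpDr ?sumr_ge0.
have tbig i : r i != 0 -> s i + t * r i != 0.
  move=> ri; apply/negP => /eqP str.
  have : `|s i / r i| = t.
    rewrite (_ : s i / r i = - t) ?normrN ?gtr0_norm //.
    by apply: (mulIf ri); rewrite divfK // mulNr; apply/eqP;
      rewrite -addr_eq0 str.
  apply/eqP; rewrite lt_eqF // /t (bigD1 i) //= addrCA ltrDl ltr_wpDr ?ltr01 //.
  exact: sumr_ge0.
have tK : Defs.transversal (revolute_axis A) (line p (n + t *: m)).
  split.
    exists p, (n + t *: m); split => //; apply/negP => /eqP nt0.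
    case/negP: nm; apply/eqP.
    have -> : n = (- t) *: m
      by rewrite scaleNr; apply/eqP; rewrite -addr_eq0 nt0.
    by apply: col3P; rewrite !(crossE, mxE); ring.
  move=> i; have [ri0|ri0] := eqVneq (r i) 0.
    exists p; split; first by exists 0; rewrite ?scale0r ?addr0.
    by have := rK i; rewrite ri0 scale0r addr0.
  exists (p + (r i * s i / (s i + t * r i)) *: (n + t *: m)).
  split; first by eexists.
  rewrite (_ : _ + _ = p + r i *: n
     + (t * r i / (s i + t * r i)) *: (p + s i *: m - (p + r i *: n))).
    exact: axis_affine.
  by apply/matrixP => j k; rewrite !mxE; field; exact: tbig.
have [LN|LM] := uniqNM _ tK.
  have : line p (n + t *: m) (p + (n + t *: m)) by exists 1; rewrite ?scale1r.
  rewrite LN => -[x _ /addrI xE]; case/negP: nm; apply/eqP.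
  have -> : m = (t^-1 * (x - 1)) *: n.
    rewrite -scalerA scalerBl scale1r xE addrC addKr scalerA mulVf ?scale1r //.
    by rewrite gt_eqF.
  by apply: col3P; rewrite !(crossE, mxE); ring.
have : line p (n + t *: m) (p + (n + t *: m)) by exists 1; rewrite ?scale1r.
rewrite LM => -[x _ /addrI xE]; case/negP: nm; apply/eqP.
have -> : n = (x - t) *: m by rewrite scalerBl xE addrK.
by apply: col3P; rewrite !(crossE, mxE); ring.
Qed.

(** Otherwise the transversals are concurrent, or they span a plane containing the first two axes,
    which then are not skew. *)
Lemma transversals_not_coplanar A p n q m (r s : 'I_4 -> R) :
  exactly_two_transversals (revolute_axis A) (line p n) (line q m) ->
  skew_lines (revolute_axis A 0) (revolute_axis A 1) ->
  (forall i, revolute_axis A i (p + r i *: n)) ->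
  (forall i, revolute_axis A i (q + s i *: m)) ->
  n != 0 -> m != 0 -> dot (q - p) n = 0 -> dot (q - p) m = 0 ->
  dot m (cross n (q - p)) != 0.
Proof.
move=> two skew rK sK n0 m0 Dn Dm.
have pq : p != q.
  apply/negP => /eqP pq; move: sK two; rewrite -pq => sK.
  exact: transversals_not_concurrent rK sK n0 m0.
(* A common point would make [q - p] a combination of [n] and [m], hence orthogonal to itself. *)
have PQ i : p + r i *: n != q + s i *: m.
  apply/negP => /eqP PQ; case/negP: pq; rewrite eq_sym -subr_eq0 -dot_eq0.
  have DE : q - p = r i *: n - s i *: m.
    apply/eqP; rewrite -subr_eq0; apply/eqP.
    transitivity (q + s i *: m - (p + r i *: n)); last by rewrite PQ subrr.
    by apply/matrixP => j k; rewrite !mxE; ring.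
  rewrite {2}DE; apply/eqP.
  transitivity (r i * dot (q - p) n - s i * dot (q - p) m).
    by rewrite !(dotE, mxE); ring.
  by rewrite Dn Dm !mulr0 subrr.
apply/negP => /eqP tri0; have [line0 line1 _ _] := skew.
move: skew; rewrite (line_through line0 (rK 0) (sK 0) (PQ 0)).
rewrite (line_through line1 (rK 1) (sK 1) (PQ 1)).
apply: coplanar_not_skew; rewrite ?subr_eq0 1?eq_sym //.
transitivity ((r 1 - r 0) * (s 1 - s 0) * dot m (cross n (q - p))).
  by rewrite !(dotE, crossE, mxE); ring.
by rewrite tri0 mulr0.
Qed.

Lemma transversal_points A p n :
  Defs.transversal (revolute_axis A) (line p n) ->
  exists r : 'I_4 -> R, forall i, revolute_axis A i (p + r i *: n).
Proof.
move=> [_ meet].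
have /choice[r rK] : forall i, exists t, revolute_axis A i (p + t *: n).
  by move=> i; have [_ [[t _ <-] Kt]] := meet i; exists t.
by exists r.
Qed.

(** If [r] repeats, the two axes meet on the transversal. If both positions agree on [n], they agree
    on the whole transversal, so the axis [K_{i,i+1}] contains its point on the next axis. *)
Lemma transversal_moves A p n (r : 'I_4 -> R) i :
  skew_lines (revolute_axis A i) (revolute_axis A (ordS i)) ->
  (forall j, revolute_axis A j (p + r j *: n)) ->
  r (ordS i) != r i /\ lin (A i) *m n <> lin (A (ordS i)) *m n.
Proof.
move=> [_ _ disj _] rK.
have absurd : ~ revolute_axis A i (p + r (ordS i) *: n).
  move=> Ki; suff : (revolute_axis A i `&` revolute_axis A (ordS i))
      (p + r (ordS i) *: n) by rewrite disj.
  by split.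
split; first by apply/negP => /eqP rE; apply: absurd; rewrite rE.
move=> nE; apply: absurd; rewrite /revolute_axis /=.
have shiftE (B : displacement R) :
    B (p + r (ordS i) *: n) =
    B (p + r i *: n) + (r (ordS i) - r i) *: (lin B *m n).
  by rewrite -dapplyDZ -addrA -scalerDl subrKC.
by rewrite !shiftE nE (rK i).
Qed.

Lemma elementary_quadrilateral_homologous A p n (r : 'I_4 -> R) :
  (forall i, revolute_axis A i (p + r i *: n)) ->
  elementary_quadrilateral (homologous_images A (p, n)).
Proof.
by move=> rK i; exists (r i); rewrite /= -!dapplyDZ; exact: rK.
Qed.

End Transversals.

(** * Assembly for both contact elements *)

Theorem theorem8 (R : realType) (A : 'I_4 -> displacement R)
    (N M : set (E3 R)) (p n q m : E3 R)
    (A_rot : rotation_quadrilateral A)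
    (NM_transversals : exactly_two_transversals (revolute_axis A) N M)
    (axes_skew : forall i,
       skew_lines (revolute_axis A i) (revolute_axis A (ordS i)))
    (n_unit : norm2 n = 1) (m_unit : norm2 m = 1)
    (N_line : N = line p n) (M_line : M = line q m)
    (pq_perp_n : dot (q - p) n = 0) (pq_perp_m : dot (q - p) m = 0)
    (Kp_defined : curvature_well_defined (homologous_images A (p, n)))
    (Kq_defined : curvature_well_defined (homologous_images A (q, m))) :
  [/\ elementary_quadrilateral (homologous_images A (p, n)),
      elementary_quadrilateral (homologous_images A (q, m)),
      has_gaussian_curvature (homologous_images A (p, n))
        (- twist p n q m ^+ 2),
      has_gaussian_curvature (homologous_images A (q, m))
        (- twist p n q m ^+ 2) &
      - twist p n q m ^+ 2 = - (sin (angle n m) ^+ 2 / norm2 (q - p) ^+ 2)].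
Proof.
rewrite {}N_line {}M_line in NM_transversals.
have [tN tM _ _] := NM_transversals.
have [r rK] := transversal_points tN; have [s sK] := transversal_points tM.
have nn : dot n n = 1 by rewrite -norm2_sqr n_unit expr1n.
have mm : dot m m = 1 by rewrite -norm2_sqr m_unit expr1n.
have n0 : n != 0 by rewrite -dot_eq0 nn oner_neq0.
have m0 : m != 0 by rewrite -dot_eq0 mm oner_neq0.
have skew01 : skew_lines (revolute_axis A 0) (revolute_axis A 1).
  by have := axes_skew 0; rewrite ordS4E.
have tri := transversals_not_coplanar NM_transversals skew01 rK sK n0 m0
  pq_perp_n pq_perp_m.
have D0 : q - p != 0.
  apply: contraNneq tri => ->; apply/eqP.
  by rewrite !(dotE, crossE, mxE); ring.
have nS i := (transversal_moves (axes_skew i) rK).2.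
have mS i := (transversal_moves (axes_skew i) sK).2.
have := (transversal_moves (axes_skew 2) rK).1.
have := (transversal_moves (axes_skew 2) sK).1.
rewrite !ordS4E => s32 r32.
rewrite twist_sqr // sin_angle_sqr // norm2_sqr.
have swap : p - q = - (q - p) by rewrite opprB.
have dotN (u v : E3 R) : dot (- u) v = - dot u v.
  by rewrite !(dotE, mxE); ring.
split => //.
- exact: elementary_quadrilateral_homologous rK.
- exact: elementary_quadrilateral_homologous sK.
(* The roles of [N] and [M] are exchanged here; [q - p] changes sign, while the triple product is
   unchanged. *)
- have -> : dot (q - p) (q - p) = dot (p - q) (p - q).
    by rewrite !(dotE, mxE); ring.
  rewrite dotC; apply: (gaussian_curvature_homologous sK rK) => //.
  + by rewrite swap dotN pq_perp_m oppr0.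
  + by rewrite swap dotN pq_perp_n oppr0.
  + by rewrite swap oppr_eq0.
  + rewrite (_ : dot n _ = dot m (cross n (q - p))) //.
    by rewrite !(dotE, crossE, mxE); ring.
- exact: (gaussian_curvature_homologous rK sK).
Qed.
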